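(* Let $\Phi$ be a real, additive gain graph on $n$ vertices and assume $n>d\geq 1$. Then the set of $n$-tuples $\mathbf{Q}=(Q_1,\dots,Q_n)\in(\mathbb{E}^d)^n$ that have ideal general position, general position with respect to $\Phi$, and projective general position with respect to $\Phi$ contains an open dense subset of $(\mathbb{E}^d)^n$.
   Context: A real, additive gain graph $\Phi$ on $V=\{1,\dots,n\}$: finite graph with edge set $E$ (multiple edges allowed, every edge with two distinct endpoints) and gains $\phi(e;i,j)\in\mathbb{R}$ with $\phi(e;j,i)=-\phi(e;i,j)$. $S\subseteq E$ is balanced if every circle in $S$ has gain sum $0$ (read consistently around the circle); $c(S)$ is the number of components of $(V,S)$, isolated vertices included. With $\psi_{ij}(P)=d(P,Q_i)^2-d(P,Q_j)^2$, the Pythagorean arrangement $\mathcal{H}=\mathcal{H}(\Phi;\mathbf{Q})$ consists of the hyperplanes $h(e)=\{P\in\mathbb{E}^d:\psi_{ij}(P)=\phi(e;i,j)\}$ for edges $e$ with endpoints $i,j$ (defined when $Q_i\neq Q_j$ for adjacent $i,j$). $\mathcal{L}(\mathcal{H})$ is the set of nonempty intersections of subsets of $\mathcal{H}$ (including $\mathbb{E}^d$), ordered by reverse inclusion; for $s\in\mathcal{L}(\mathcal{H})$, $E(s)=\{e:h(e)\supseteq s\}$. Balanced flats: a balanced $S\subseteq E$ is a balanced flat if every $e\in E\setminus S$ with both endpoints in one component of $(V,S)$ makes $S\cup\{e\}$ unbalanced; its rank is $n-c(S)$. $[\mathrm{Lat}^b\Phi]_0^d$ is the poset (under inclusion) of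 balanced flats of rank at most $d$. Complete lift matroid $L_0(\Phi)$: ground set $E\cup\{e_0\}$ ($e_0\notin E$), rank function $r(S)=n-c(S\setminus\{e_0\})+\epsilon$, where $\epsilon=0$ if $S$ is a balanced subset of $E$ and $\epsilon=1$ otherwise; $\mathrm{Lat}\,L_0(\Phi)$ is its lattice of flats and $T_{d+1}(\mathrm{Lat}\,L_0(\Phi))$ its truncation, in which all flats of rank $\geq d+1$ are replaced by the single top element $E\cup\{e_0\}$. Ideal general position (IGP): the points are distinct and, embedding $\mathbb{E}^d\subset\mathbb{P}^d$ with ideal hyperplane $h_\infty$ and letting $p_{ij}$ be the ideal point of line $Q_iQ_j$, for every set $T$ of unordered pairs $\{i,j\}$ the projective span of $\{p_{ij}:\{i,j\}\in T\}$ has dimension $\min(n-c(T),d)-1$, where $c(T)$ counts components of the graph $(\{1,\dots,n\},T)$. General position with respect to $\Phi$ (GP): $\mathcal{H}(\Phi;\mathbf{Q})$ is defined and $s\mapsto E(s)$ is a poset isomorphism from $\mathcal{L}(\mathcal{H})$ onto $[\mathrm{Lat}^b\Phi]_0^d$. Projective general position with respect to $\Phi$ (PGP): with $\mathcal{H}_{\mathbb{P}}=\{h(e)_{\mathbb{P}}:e\in E\}\cup\{h_\infty\}$ ($h_{\mathbb{P}}$ = projective closure), the lattice $\mathcal{L}(\mathcal{H}_{\mathbb{P}})$ of all intersections of subsets of $\mathcal{H}_{\mathbb{P}}$ in $\mathbb{P}^d$ (ordered by reverse inclusion) is isomorphic to $T_{d+1}(\mathrm{Lat}\,L_0(\Phi))$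 via $x\mapsto\{e\in E:h(e)_{\mathbb{P}}\supseteq x\}\cup\{e_0: h_\infty\supseteq x\}$. *)

(* Defs.v *)
From HB Require Import structures.
From mathcomp Require Import all_boot all_order all_algebra.
From mathcomp Require Import all_classical all_reals all_analysis.
Set Implicit Arguments. Unset Strict Implicit. Unset Printing Implicit Defensive.
Import Order.TTheory GRing.Theory Num.Theory.
Local Open Scope classical_set_scope.
Local Open Scope ring_scope.

(* A real additive gain graph on V = 'I_n: a finite type E of edges, each edge
   e oriented by  ends e = (i, j)  with i <> j (hypothesis of the theorem),
   with gain  phi(e; i, j) = g e  and  phi(e; j, i) = - g e. *)
Section GainGraph.
Variables (R : realType) (n : nat) (E : finType)
  (ends : E -> 'I_n * 'I_n) (g : E -> R).

Definition tl (e : E) : 'I_n := (ends e).1.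
Definition hd (e : E) : 'I_n := (ends e).2.

Definition joins (e : E) (u v : 'I_n) : bool :=
  (ends e == (u, v)) || (ends e == (v, u)).

Definition gain (e : E) (u v : 'I_n) : R :=
  if ends e == (u, v) then g e else if ends e == (v, u) then - g e else 0.

(* S is balanced: every circle in S (k+2 >= 2 distinct vertices vs 0, ..., vs (k+1)
   and distinct edges es i joining vs i and vs (i+1 mod k+2)) has gain sum 0
   read consistently around the circle. *)
Definition balanced (S : {set E}) : Prop :=
  forall (k : nat) (vs : 'I_k.+2 -> 'I_n) (es : 'I_k.+2 -> E),
    injective vs -> injective es ->
    (forall i, es i \in S) ->
    (forall i, joins (es i) (vs i) (vs (ordS i))) ->
    \sum_(i < k.+2) gain (es i) (vs i) (vs (ordS i)) = 0.

Definition adj (S : {set E}) : rel 'I_n :=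
  fun u v => [exists e in S, joins e u v].

Definition ncomp (S : {set E}) : nat := n_comp (adj S) 'I_n.

Definition bal_flat (S : {set E}) : Prop :=
  balanced S /\
  forall e, e \notin S -> connect (adj S) (tl e) (hd e) ->
    ~ balanced (S :|: [set e]).

Definition frank (S : {set E}) : nat := (n - ncomp S)%N.

(* Complete lift matroid L_0: ground set option E, with None playing e_0. *)
Definition edges_of (S : {set option E}) : {set E} := [set e | Some e \in S].

Definition lrank (S : {set option E}) : nat :=
  ((n - ncomp (edges_of S)) +
   (if (None \notin S) && `[< balanced (edges_of S) >] then 0 else 1))%N.

Definition lflat (S : {set option E}) : Prop :=
  forall x, x \notin S -> (lrank S < lrank (x |: S))%N.

(* elements of the truncation T_{d+1}(Lat L_0): flats of rank <= d, and the top *)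
Definition trunc_elt (d : nat) (S : {set option E}) : Prop :=
  (lflat S /\ (lrank S <= d)%N) \/ S = [set: option E]%SET.

Variable d : nat.
(* a configuration Q in (E^d)^n : row i Q is the point Q_i *)

Definition dotr (u v : 'rV[R]_d) : R := (u *m v^T) 0 0.
Definition sqdist (u v : 'rV[R]_d) : R := dotr (u - v) (u - v).

Definition psi (Q : 'M[R]_(n, d)) (i j : 'I_n) (P : 'rV[R]_d) : R :=
  sqdist P (row i Q) - sqdist P (row j Q).

Definition hyp (Q : 'M[R]_(n, d)) (e : E) : set 'rV[R]_d :=
  [set P | psi Q (tl e) (hd e) P = g e].

Definition arr_defined (Q : 'M[R]_(n, d)) : Prop :=
  forall e, row (tl e) Q != row (hd e) Q.

Definition interA (Q : 'M[R]_(n, d)) (T : {set E}) : set 'rV[R]_d :=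
  [set P | forall e, e \in T -> hyp Q e P].

Definition inLA (Q : 'M[R]_(n, d)) (s : set 'rV[R]_d) : Prop :=
  (exists T : {set E}, s = interA Q T) /\ s !=set0.

Definition EofA (Q : 'M[R]_(n, d)) (s : set 'rV[R]_d) : {set E} :=
  [set e | `[< s `<=` hyp Q e >]].

(* General position w.r.t. Phi: s |-> E(s) is a poset isomorphism from
   (L(H), reverse inclusion) onto ([Lat^b Phi]_0^d, inclusion). *)
Definition GP (Q : 'M[R]_(n, d)) : Prop :=
  [/\ arr_defined Q,
      (forall s, inLA Q s -> bal_flat (EofA Q s) /\ (frank (EofA Q s) <= d)%N),
      (forall S, bal_flat S -> (frank S <= d)%N ->
                 exists s, inLA Q s /\ EofA Q s = S) &
      (forall s t, inLA Q s -> inLA Q t ->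
                 (t `<=` s <-> EofA Q s \subset EofA Q t))].

(* Projective space P^d via homogeneous coordinates (x, x0) in R^d x R;
   a projective subspace is represented by the corresponding linear subspace.
   P = x / x0 for x0 <> 0; h_infinity = {x0 = 0}. *)
Definition hinf : set ('rV[R]_d * R) := [set x | x.2 = 0].

(* Projective closure of h(e): psi_{ij}(P) = -2 P.(Q_i - Q_j) + |Q_i|^2 - |Q_j|^2,
   so h(e) = {P | -2 P.(Q_i-Q_j) = g e - |Q_i|^2 + |Q_j|^2}, whose closure is the
   homogenized equation below. *)
Definition hypP (Q : 'M[R]_(n, d)) (e : E) : set ('rV[R]_d * R) :=
  [set x | dotr x.1 (- (2%:R) *: (row (tl e) Q - row (hd e) Q)) =
           (g e - dotr (row (tl e) Q) (row (tl e) Q)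
                + dotr (row (hd e) Q) (row (hd e) Q)) * x.2].

Definition hP (Q : 'M[R]_(n, d)) (o : option E) : set ('rV[R]_d * R) :=
  match o with Some e => hypP Q e | None => hinf end.

Definition interP (Q : 'M[R]_(n, d)) (T : {set option E}) : set ('rV[R]_d * R) :=
  [set x | forall o, o \in T -> hP Q o x].

(* x in L(H_P) (all intersections, including the empty projective set) *)
Definition inLP (Q : 'M[R]_(n, d)) (x : set ('rV[R]_d * R)) : Prop :=
  exists T : {set option E}, x = interP Q T.

Definition EofP (Q : 'M[R]_(n, d)) (x : set ('rV[R]_d * R)) : {set option E} :=
  [set o | `[< x `<=` hP Q o >]].

Definition PGP (Q : 'M[R]_(n, d)) : Prop :=
  [/\ arr_defined Q,
      (forall x, inLP Q x -> trunc_elt d (EofP Q x)),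
      (forall S, trunc_elt d S -> exists x, inLP Q x /\ EofP Q x = S) &
      (forall x y, inLP Q x -> inLP Q y ->
                 (y `<=` x <-> EofP Q x \subset EofP Q y))].

End GainGraph.

Section IGP.
Variables (R : realType) (n d : nat).

Definition pair_ncomp (T : {set 'I_n * 'I_n}) : nat :=
  n_comp [rel i j | ((i, j) \in T) || ((j, i) \in T)] 'I_n.

(* unordered pairs {i,j} are encoded as ordered pairs (i, j) with i < j; the
   ideal point p_ij is the direction Q_i - Q_j, and the projective span of
   a set of ideal points has dimension (rank of the directions) - 1. *)
Definition IGP (Q : 'M[R]_(n, d)) : Prop :=
  injective (fun i : 'I_n => row i Q) /\
  forall T : {set 'I_n * 'I_n}, (forall p, p \in T -> (p.1 < p.2)%N) ->
    \rank (\big[@addsmx R d d d/0]_(p in T) <<row p.1 Q - row p.2 Q>>%MS) = minn (n - pair_ncomp T) d.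

End IGP.

(* Main.v *)
Require Import Defs.
From HB Require Import structures.
From mathcomp Require Import all_boot all_order all_algebra.
From mathcomp Require Import all_classical all_reals all_analysis.
From mathcomp Require Import zify ring lra.
Import Order.TTheory GRing.Theory Num.Theory.
Import numFieldNormedType.Exports.
Local Open Scope classical_set_scope.
Local Open Scope ring_scope.

Set Implicit Arguments.
Unset Strict Implicit.

(* The edge e = (i, j) contributes to the projective arrangement the linear form
   f(Q_i) - f(Q_j) - g(e) h on R^d x R, where f(q) = (-2q, |q|^2) and h = (0, 1)
   is the form of h_infinity; these are the rows of N B(Q), where the fixed
   matrix N has rows (delta_i - delta_j, -g(e)) and (0, 1), and B(Q) has rows
   f(Q_1), ..., f(Q_n), h.  The rows of N represent the complete lift matroid.
   For generic Q, every row submatrix N' of N satisfies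
   rank (N' B(Q)) = min (rank N', d + 1): if the rank is smaller, then some w has
   w N' B(Q) = 0 and w N' <> 0; w N' is then nonzero at some vertex i, and a
   small move of Q_i alone adds to N' B(Q) a rank-one matrix which raises the
   rank.  So the matroid of the
   projective arrangement is the truncated lift matroid, which is PGP.  GP
   follows because the affine flats are the projective ones that do not lie in
   h_infinity, and IGP is the same perturbation argument with f(q) = q and
   without h. *)

(** * Generic ranks *)

(** The rank normal form of [M x] gives fixed [L], [C] with [L *m M x *m C = 1]. The determinant of
    [L *m M y *m C] is continuous in [y], so it stays nonzero near [x], where [M y] then has at
    least the rank of [M x]. *)
Lemma open_rank_geq (R : realType) (T : topologicalType) (m p r : nat)
    (M : T -> 'M[R]_(m, p)) :
  (forall i j, continuous (fun x => M x i j)) ->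
  open [set x | (r <= \rank (M x))%N].
Proof.
move=> M_cont; rewrite openE => x /= rx; rewrite /interior.
pose s := \rank (M x).
pose L : 'M[R]_(s, m) := pid_mx s *m invmx (col_ebase (M x)).
pose C : 'M[R]_(p, s) := invmx (row_ebase (M x)) *m pid_mx s.
have LMC : L *m M x *m C = 1%:M.
  rewrite -[X in L *m X](mulmx_ebase (M x)) /L /C !mulmxA mulmxKV ?col_ebase_unit//.
  rewrite mulmxK ?row_ebase_unit// !mul_pid_mx !minnn.
  have -> : minn p (minn (minn m s) s) = s.
    have := rank_leq_row (M x); have := rank_leq_col (M x); rewrite -/s; lia.
  by rewrite pid_mx_1.
have D_cont : continuous (fun y => \det (L *m M y *m C)).
  rewrite /determinant; apply: continuous_big; first exact: add_continuous.
  move=> t _ y; apply: cvgM; first exact: cvg_cst.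
  apply: cvg_big; first exact: mul_continuous.
  move=> i _; under eq_cvg do rewrite mxE; rewrite mxE.
  apply: cvg_big; first exact: add_continuous.
  move=> j _; apply: cvgM; last exact: cvg_cst.
  under eq_cvg do rewrite mxE; rewrite mxE.
  apply: cvg_big; first exact: add_continuous.
  by move=> a _; apply: cvgM; [exact: cvg_cst | exact: M_cont].
have D_open : open [set y | \det (L *m M y *m C) != 0].
  apply: (@open_comp _ _ (fun y => \det (L *m M y *m C)) [set a | a != 0]).
    by move=> y _; exact: D_cont.
  exact: open_neq.
have : nbhs x [set y | \det (L *m M y *m C) != 0].
  by apply: open_nbhs_nbhs; split=> //=; rewrite LMC det1 oner_neq0.
apply: filterS => y /= Dy; apply: (leq_trans rx).
have : L *m M y *m C \in unitmx by rewrite unitmxE unitfE.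
move=> /mxrank_unit rs; rewrite -/s -[X in (X <= _)%N]rs.
by rewrite (leq_trans (mxrankM_maxl _ _)) ?mxrankM_maxr.
Qed.

(** Applying [w] to the sum leaves a nonzero multiple of [u], so [u], and with it [M], lies in the
    row space of the sum. The inclusion is strict because [l] annihilates the rows of [M] but not
    [u]. *)
Lemma ltn_rank_update (F : fieldType) (m p : nat) (M : 'M[F]_(m, p))
    (a : 'cV_m) (u : 'rV_p) (w : 'rV_m) (l : 'cV_p) :
  w *m M = 0 -> w *m a != 0 -> M *m l = 0 -> u *m l != 0 ->
  (\rank M < \rank (M + a *m u)%R)%N.
Proof.
move=> wM wa Ml ul; apply: rank_ltmx.
have uM' : (u <= (M + a *m u)%R)%MS.
  have eq_w : w *m (M + a *m u) = (w *m a) 0 0 *: u.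
    by rewrite mulmxDr wM add0r mulmxA [w *m a]mx11_scalar mul_scalar_mx !mxE.
  have wa0 : (w *m a) 0 0 != 0.
    by apply: contra wa => /eqP wa0; rewrite [w *m a]mx11_scalar wa0 raddf0.
  apply/submxP; exists (((w *m a) 0 0)^-1 *: w).
  by rewrite -scalemxAl eq_w scalerA mulVf// scale1r.
rewrite ltmxE; apply/andP; split.
  have {1}-> : M = (M + a *m u) - a *m u by rewrite addrK.
  by rewrite addmx_sub // -mulmxN mulmx_sub// (eqmx_opp u).
apply: contra ul => /(submx_trans uM') /submxP[D ->].
by rewrite -mulmxA Ml mulmx0.
Qed.

(** Both left kernels live in the space of rows of length [m], so a drop in rank makes the kernel of
    [N *m B] too large to fit inside that of [N]. *)
Lemma left_kernel_witness (F : fieldType) (m q p : nat) (N : 'M[F]_(m, q))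
    (B : 'M[F]_(q, p)) : (\rank (N *m B) < \rank N)%N ->
  exists2 w : 'rV_m, w *m (N *m B) = 0 & w *m N != 0.
Proof.
move=> ltr; have : ~~ (kermx (N *m B) <= kermx N)%MS.
  apply: contraTN ltr => /mxrankS; rewrite !mxrank_ker -leqNgt => h.
  have := rank_leq_row N; have := rank_leq_row (N *m B); lia.
case/row_subPn => i wN; exists (row i (kermx (N *m B))).
  by rewrite -row_mul mulmx_ker row0.
by apply: contra wN => /eqP wN; apply/sub_kermxP.
Qed.

(** * Raising the rank by moving a single point *)

Section Perturbation.
Variables (R : realType) (n d p k m : nat).
Variables (f : 'rV[R]_d -> 'rV[R]_p) (K : 'M[R]_(k, p)).

(** The rows of [K] do not depend on [Q]: there is one, the form of the ideal hyperplane, for the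
    arrangement, and none for the ideal points. *)
Definition image_mx (Q : 'M[R]_(n, d)) : 'M[R]_(n + k, p) :=
  col_mx (\matrix_i f (row i Q)) K.

(* Arbitrarily small moves of q displace f q out of any given hyperplane. *)
Definition locally_spanning := forall (q : 'rV[R]_d) (l : 'cV[R]_p), l != 0 ->
  exists c : 'rV[R]_d,
    forall e : R, 0 < e -> exists2 t : R, `|t| < e & (f (q + t *: c) - f q) *m l != 0.

Lemma line_nbhs (Q Y : 'M[R]_(n, d)) (O : set 'M[R]_(n, d)) :
  open O -> O Q -> exists2 e : R, 0 < e & forall t, `|t| < e -> O (Q + t *: Y).
Proof.
move=> oO OQ; have : nbhs Q O by apply: open_nbhs_nbhs.
have cvgl : (fun t : R => Q + t *: Y) @ (0 : R) --> Q + (0 : R) *: Y.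
  by apply: cvgD; [exact: cvg_cst | apply: cvgZr_tmp; exact: cvg_id].
rewrite -[Q in nbhs Q](addr0 Q) -[X in Q + X](scale0r Y) => /cvgl.
move=> /nbhs_ballP[e e0 he]; exists e => // t te.
by apply: he; rewrite /ball/= sub0r normrN.
Qed.

Hypothesis f_span : locally_spanning.
Hypothesis K_free : row_free K.

Lemma image_mx_update (Q : 'M[R]_(n, d)) i x :
  image_mx (Q + delta_mx i 0 *m x) =
  image_mx Q + delta_mx (lshift k i) 0 *m (f (row i Q + x) - f (row i Q)).
Proof.
rewrite /image_mx delta_mx_ushift mul_col_mx mul0mx add_col_mx addr0.
have row_delta q (y : 'rV[R]_q) j :
    row j (delta_mx i 0 *m y : 'M[R]_(n, q)) = (j == i)%:R *: y.
  by apply/rowP => c; rewrite !mxE big_ord1 !mxE eqxx andbT.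
congr col_mx; apply/row_matrixP => j; rewrite linearD /= !rowK linearD /= !row_delta.
case: eqVneq => [->|_]; first by rewrite !scale1r [RHS]addrC subrK.
by rewrite !scale0r !addr0.
Qed.

Lemma rank_increase (N : 'M[R]_(m, n + k)) (O : set 'M[R]_(n, d)) Q :
  open O -> O Q -> (\rank (N *m image_mx Q) < minn (\rank N) p)%N ->
  exists2 Q', O Q' & (\rank (N *m image_mx Q) < \rank (N *m image_mx Q'))%N.
Proof.
move=> oO OQ; rewrite ltn_min => /andP[ltN ltp].
have [w wM wN] := left_kernel_witness ltN.
have [l Ml l0] : exists2 l : 'cV_p, N *m image_mx Q *m l = 0 & l != 0.
  have: cokermx (N *m image_mx Q) != 0.
    by rewrite -mxrank_eq0 mxrank_coker subn_eq0 -ltnNge.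
  case/matrix0Pn => i [j cij]; exists (col j (cokermx (N *m image_mx Q))).
    by rewrite colE mulmxA mulmx_coker mul0mx.
  by apply/matrix0Pn; exists i, 0; rewrite mxE.
(* If [w *m N] vanished at all vertices, [w *m N *m image_mx Q = 0] would be a relation between the
   independent rows of [K], forcing [w *m N = 0]. *)
have [i wi] : exists i, (w *m N) 0 (lshift k i) != 0.
  apply/existsP; apply: contraNT wN; rewrite negb_exists => /forallP w0.
  have lw0 : lsubmx (w *m N) = 0.
    by apply/rowP => i; rewrite !mxE; apply/eqP; have := w0 i; rewrite mxE negbK.
  move: wM; rewrite mulmxA -[w *m N]hsubmxK lw0 mul_row_col mul0mx add0r => wK.
  have -> : rsubmx (w *m N) = 0.
    by apply: (row_free_inj K_free); rewrite wK mul0mx.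
  by rewrite row_mx0.
have [c hc] := f_span (row i Q) l0.
have [e e0 he] := line_nbhs (delta_mx i 0 *m c) oO OQ.
have [t te ht] := hc e e0.
exists (Q + t *: (delta_mx i 0 *m c)); first exact: he.
(* Only point [i] moves, so the product changes by column [i] of [N] times the increment of [f]; [w]
   is nonzero on the first factor and [l] on the second. *)
rewrite scalemxAr image_mx_update mulmxDr mulmxA.
apply: (@ltn_rank_update _ _ _ _ _ _ w l) => //.
apply: contra wi => /eqP/matrixP/(_ 0 0).
by rewrite mulmxA -colE !mxE => ->.
Qed.

(** Induction on the rank deficiency: each perturbation stays in the given open set and lowers
    it. *)
Lemma generic_rank_dense (N : 'M[R]_(m, n + k)) :
  dense [set Q | (minn (\rank N) p <= \rank (N *m image_mx Q))%N].
Proof.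
move=> O [Q OQ] oO.
have [b] := ubnP (minn (\rank N) p - \rank (N *m image_mx Q)).
elim: b Q OQ => // b IHb Q OQ; rewrite ltnS => leb.
have [?|ltr] := leqP (minn (\rank N) p) (\rank (N *m image_mx Q)).
  by exists Q.
have [Q' OQ' lt'] := rank_increase oO OQ ltr.
apply: (IHb Q') => //; rewrite (leq_trans _ leb)// ltn_sub2l//.
Qed.

Lemma row_continuous i : continuous (fun Q : 'M[R]_(n, d) => row i Q).
Proof.
move=> Q A [P hP sPA].
exists (fun a b => if a == i then P 0 b else setT).
  by move=> a b; case: eqVneq => [->|_]; [have := hP 0 b; rewrite mxE | exact: filterT].
move=> Q' hQ'; apply: sPA => a b; rewrite ord1 mxE.
by have := hQ' i b; rewrite eqxx.
Qed.

Lemma generic_rank_open (N : 'M[R]_(m, n + k)) (r : nat) :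
  (forall j, continuous (fun q => f q 0 j)) ->
  open [set Q | (r <= \rank (N *m image_mx Q))%N].
Proof.
move=> f_cont; apply: open_rank_geq => i j.
under eq_fun do rewrite mxE.
apply: continuous_big; first exact: add_continuous.
move=> x _.
have B_cont : continuous (fun Q => image_mx Q x j).
  rewrite /image_mx; case: (split_ordP x) => x' ->; last first.
    by under eq_fun do rewrite col_mxEd; exact: cst_continuous.
  under eq_fun do rewrite col_mxEu mxE; move=> Q.
  exact: (@continuous_comp _ _ _ (fun Q => row x' Q) (fun q => f q 0 j) Q
    (@row_continuous x' Q) (f_cont j (row x' Q))).
move=> Q; apply: (@cvgM _ _ (nbhs Q) _ (fun=> N i x) _ _ _ _ (B_cont Q)).
exact: cvg_cst.
Qed.

End Perturbation.

(** * The complete lift matroid as a row matroid *)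

Section Span.
Variables (F : fieldType) (I : finType) (m : nat).
Implicit Types (S : {set I}) (v : I -> 'rV[F]_m).

(** Vectors outside [S] become zero rows instead of being deleted, so that all subsets give matrices
    of one shape. *)
Definition span_mx v S : 'M[F]_(#|I|, m) :=
  \matrix_a (if enum_val a \in S then v (enum_val a) else 0).

Lemma span_mx_in v S i : i \in S -> (v i <= span_mx v S)%MS.
Proof.
move=> iS; apply: (submx_trans _ (row_sub (enum_rank i) _)).
by rewrite rowK enum_rankK iS.
Qed.

Lemma span_mx_sub v S p (A : 'M[F]_(p, m)) :
  (forall i, i \in S -> (v i <= A)%MS) -> (span_mx v S <= A)%MS.
Proof.
move=> h; apply/row_subP => a; rewrite rowK.
by case: ifP => [/h//|_]; exact: sub0mx.
Qed.

Lemma span_mxS v S S' : S \subset S' -> (span_mx v S <= span_mx v S')%MS.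
Proof.
by move=> /fintype.subsetP sSS'; apply: span_mx_sub => i /sSS' /span_mx_in.
Qed.

Lemma span_mxU1 v S i : (span_mx v (i |: S) :=: span_mx v S + v i)%MS.
Proof.
apply/eqmxP/andP; split.
  apply: span_mx_sub => j /finset.setU1P[->|/span_mx_in jS]; first exact: addsmxSr.
  by rewrite (submx_trans (jS v))// addsmxSl.
rewrite addsmx_sub; apply/andP; split; first exact/span_mxS/finset.subsetUr.
exact/span_mx_in/finset.setU11.
Qed.

Lemma span_mx_eq0 v S p (B : 'M[F]_(m, p)) :
  (forall i, i \in S -> v i *m B = 0) -> span_mx v S *m B = 0.
Proof.
move=> h; apply/row_matrixP => a; rewrite row_mul rowK row0.
by case: ifP => [/h//|_]; rewrite mul0mx.
Qed.

Lemma rank_span_mxU1 v S i :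
  (\rank (span_mx v (i |: S)) == \rank (span_mx v S)) = (v i <= span_mx v S)%MS.
Proof.
rewrite eq_sym (mxrank_leqif_sup (span_mxS v (finset.subsetUr _ _))).
by rewrite span_mxU1 addsmx_sub submx_refl.
Qed.

End Span.

Lemma span_mxM (F : fieldType) (I : finType) (m p : nat) (v : I -> 'rV[F]_m)
    (S : {set I}) (B : 'M[F]_(m, p)) :
  span_mx v S *m B = span_mx (fun i => v i *m B) S.
Proof.
apply/row_matrixP => a; rewrite row_mul !rowK.
by case: ifP => // _; rewrite mul0mx.
Qed.

(** * Incidence vectors and components of a graph *)

Section Graph.
Variables (F : fieldType) (n : nat) (E : finType) (ends : E -> 'I_n * 'I_n).
Implicit Types (S : {set E}) (e : E) (u w : 'I_n).

Definition unit_rv u : 'rV[F]_n := delta_mx 0 u.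

Definition edge_vec e : 'rV[F]_n := unit_rv (tl ends e) - unit_rv (hd ends e).

Lemma joinsC e u w : joins ends e u w = joins ends e w u.
Proof. by rewrite /joins orbC. Qed.

Lemma adj_sym S : symmetric (adj ends S).
Proof. by move=> u w; apply: eq_existsb => e; rewrite joinsC. Qed.

Lemma adj_connect_sym S : connect_sym (adj ends S).
Proof. by apply: sym_connect_sym; exact: adj_sym. Qed.

Lemma adj_edge S e : e \in S -> adj ends S (tl ends e) (hd ends e).
Proof.
by move=> eS; apply/existsP; exists e; rewrite eS /joins -surjective_pairing eqxx.
Qed.

Lemma sub_edge_vec S e u w : e \in S -> joins ends e u w ->
  (unit_rv u - unit_rv w <= span_mx edge_vec S)%MS.
Proof.
move=> /(span_mx_in edge_vec); rewrite /edge_vec /tl /hd.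
move=> + /orP[] /eqP he; rewrite he//=.
by rewrite -(opprB (unit_rv w)) eqmx_opp.
Qed.

(** Along a path the edge vectors telescope. Conversely, the indicator column [chi] of the component
    of [u] annihilates every edge vector, but not [unit_rv u - unit_rv w] when [w] lies in another
    component. *)
Lemma sub_incidence S u w :
  (unit_rv u - unit_rv w <= span_mx edge_vec S)%MS = connect (adj ends S) u w.
Proof.
apply/idP/idP; last first.
  case/connectP => p; elim: p u => [|y p IHp] u /=.
    by move=> _ ->; rewrite subrr sub0mx.
  case/andP => /existsP[e /andP[eS euy]] py lw.
  rewrite -(subrK (unit_rv y) (unit_rv u)) -addrA.
  by rewrite addmx_sub ?IHp// (sub_edge_vec eS).
pose chi : 'cV[F]_n := \col_i (connect (adj ends S) u i)%:R.
have mul_chi i : unit_rv i *m chi = (connect (adj ends S) u i)%:R%:M.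
  by rewrite -rowE; apply/matrixP => a b; rewrite !ord1 !mxE.
have chi0 : span_mx edge_vec S *m chi = 0.
  apply: span_mx_eq0 => e /adj_edge /connect1 ce; rewrite mulmxBl !mul_chi.
  by rewrite (same_connect_r (adj_connect_sym S) ce) subrr.
case/submxP => D /(congr1 (mulmx^~ chi)) /=.
rewrite -mulmxA chi0 mulmx0 mulmxBl !mul_chi connect0.
case: connect => // /matrixP/(_ 0 0)/eqP; rewrite !mxE subr0.
by rewrite /= (negPf (oner_neq0 _)).
Qed.

(** The row space is spanned by the differences between each vertex and the root of its component;
    those at non-roots are independent, and there are [n - ncomp] of them. *)
Lemma rank_incidence S : \rank (span_mx edge_vec S) = frank ends S.
Proof.
pose r := fingraph.root (adj ends S).
have r_conn i : connect (adj ends S) i (r i) by exact: connect_root.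
pose Z : 'M[F]_n := \matrix_i (unit_rv i - unit_rv (r i)).
have eqZ : (span_mx edge_vec S :=: Z)%MS.
  apply/eqmxP/andP; split; last first.
    by apply/row_subP => i; rewrite rowK sub_incidence.
  apply: span_mx_sub => e /adj_edge /connect1 ce.
  have -> : edge_vec e = row (tl ends e) Z - row (hd ends e) Z.
    have : r (tl ends e) = r (hd ends e).
      by apply/eqP; rewrite root_connect//; exact: adj_connect_sym.
    by rewrite !rowK => ->; rewrite opprB addrA subrK.
  by rewrite addmx_sub ?eqmx_opp ?row_sub.
rewrite eqZ.
pose A := [pred i | ~~ fingraph.roots (adj ends S) i].
(* [G] selects the non-root rows. Rows of [Z] at roots vanish, so [Z = G^T *m (G *m Z)] bounds the
   rank above; deleting the root columns as well leaves the identity, which bounds it below. *)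
pose G : 'M[F]_(#|A|, n) := \matrix_a unit_rv (enum_val a).
have frankE : frank ends S = #|A|.
  rewrite /frank /ncomp /n_comp_mem.
  have -> : #|predI (fingraph.roots (adj ends S)) 'I_n| = #|fingraph.roots (adj ends S)|.
    by apply: eq_card => i; rewrite !inE andbT.
  have cardn := cardC (fingraph.roots (adj ends S)); rewrite card_ord in cardn.
  rewrite -[X in (X - _)%N]cardn addKn.
  by apply: eq_card => i; rewrite !inE.
rewrite frankE; apply/eqP; rewrite eqn_leq; apply/andP; split.
  have -> : Z = G^T *m (G *m Z).
    apply/row_matrixP => i; rewrite mulmxA row_mul.
    case: (boolP (i \in A)) => iA.
      suff -> : row i (G^T *m G) = unit_rv i by rewrite -rowE.
      apply/rowP => j; rewrite !mxE (bigD1 (enum_rank_in iA i))//= !mxE.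
      rewrite enum_rankK_in// !eqxx /= mul1r big1 ?addr0// => a ha; rewrite !mxE /=.
      suff /negPf-> : i != enum_val a by rewrite mul0r.
      by apply: contra ha => /eqP ia; apply/eqP/enum_val_inj; rewrite enum_rankK_in.
    have -> : row i (G^T *m G) = 0.
      apply/rowP => j; rewrite !mxE big1// => a _; rewrite !mxE /=.
      suff /negPf-> : i != enum_val a by rewrite mul0r.
      by apply: contra iA => /eqP->; exact: enum_valP.
    move: iA; rewrite mul0mx rowK inE negbK => /eqP ri.
    by rewrite /r ri subrr.
  by rewrite (leq_trans (mxrankM_maxl _ _))// rank_leq_col.
have GZG : G *m Z *m G^T = 1%:M.
  have mulG p (X : 'M[F]_(n, p)) a b : (G *m X) a b = X (enum_val a) b.
    transitivity (row a (G *m X) 0 b); first by rewrite [RHS]mxE.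
    by rewrite row_mul rowK -rowE mxE.
  apply/matrixP => a b; rewrite -mulmxA mulG.
  transitivity ((G *m Z^T) b (enum_val a)).
    by rewrite -{1}[Z]trmxK -trmx_mul mxE.
  rewrite mulG !mxE /= (inj_eq enum_val_inj) eq_sym.
  have /negPf -> : enum_val b != r (enum_val a).
    apply: contraTneq (enum_valP b) => ->; rewrite inE negbK.
    exact/roots_root/adj_connect_sym.
  by rewrite subr0.
by rewrite -[leqLHS](mxrank1 F #|A|) -GZG (leq_trans (mxrankM_maxl _ _))// mxrankM_maxr.
Qed.

End Graph.

(** * Potentials for balanced edge sets *)

Section Potential.
Variables (R : realType) (n : nat) (E : finType).
Variables (ends : E -> 'I_n * 'I_n) (g : E -> R).
Hypothesis loopless : forall e, (ends e).1 != (ends e).2.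
Implicit Types (S : {set E}) (e : E) (u w : 'I_n) (x : 'I_n -> R).

Definition potential x S :=
  forall e, e \in S -> g e = x (tl ends e) - x (hd ends e).

Lemma gain_potential x S e u w : potential x S -> e \in S -> joins ends e u w ->
  gain ends g e u w = x u - x w.
Proof.
rewrite /potential /joins /gain /tl /hd => xS /xS ->.
by case: eqP => [->//|_] /= /eqP ->; rewrite eqxx opprB.
Qed.

Lemma sum_cycle_diff k (y : 'I_k -> R) : \sum_i (y i - y (ordS i)) = 0.
Proof.
by rewrite sumrB [X in X - _](reindex_inj (@ordS_inj k)) subrr.
Qed.

Lemma balancedS S S' : S \subset S' -> balanced ends g S' -> balanced ends g S.
Proof.
move=> /fintype.subsetP sSS' bS' k vs es vs_inj es_inj esS.
by apply: bS' => // i; exact: sSS'.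
Qed.

(* A simple path in S from u to w closes up with e to a circle of e |: S. *)
Lemma gain_closing_edge x S e u w :
  potential x S -> e \notin S -> balanced ends g (e |: S) ->
  u != w -> joins ends e w u -> connect (adj ends S) u w ->
  gain ends g e w u = x w - x u.
Proof.
move=> xS eS bal uw ewu /connectP[p0 p0path lastp0].
case/shortenP: p0path lastp0 => p pS uniqp _ lastw.
case: p pS uniqp lastw => [_ _ /= wu|y p pS uniqp lastw].
  by rewrite wu eqxx in uw.
set q := y :: p in pS uniqp lastw.
(* The circle runs through [u :: q], and its last index [ord_max] carries [e], which leads from [w]
   back to [u]. The default of [pick_edge] is never taken, since consecutive path vertices are
   adjacent in [S]. *)
pose vs (i : 'I_(size p).+2) := nth u (u :: q) i.
pose pick_edge a b := odflt e [pick e' in S | joins ends e' a b].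
pose es (i : 'I_(size p).+2) :=
  if (i < (size p).+1)%N then pick_edge (vs i) (vs (ordS i)) else e.
have ordSE (i : 'I_(size p).+2) : (i < (size p).+1)%N -> ordS i = i.+1 :> nat.
  by move=> lti; rewrite /= modn_small.
have ord_lastE (i : 'I_(size p).+2) : ~~ (i < (size p).+1)%N -> i = ord_max.
  by move=> gei; apply/val_inj/eqP; rewrite eqn_leq -ltnS ltn_ord leqNgt.
have vs_last : vs ord_max = w by rewrite lastw /vs /= (last_nth u).
have vs_first : vs (ordS ord_max) = u by rewrite /vs /= modnn.
have es_path (i : 'I_(size p).+2) : (i < (size p).+1)%N ->
    es i \in S /\ joins ends (es i) (vs i) (vs (ordS i)).
  move=> lti; rewrite /es lti /pick_edge; case: pickP => [e' /andP[]//|no_edge].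
  have /(pathP u)/(_ i lti)/existsP[e' /andP[e'S e'j]] := pS.
  have := no_edge e'; rewrite e'S /= /vs ordSE//= => /negP[]; exact: e'j.
have es_last : es ord_max = e by rewrite /es ltnn.
have vs_inj : injective vs.
  by move=> i j /eqP; rewrite /vs nth_uniq//= => /eqP/val_inj.
have es_inj : injective es.
  have path_last (i : 'I_(size p).+2) : (i < (size p).+1)%N -> es i <> e.
    by move=> /es_path[esS _] ese; rewrite ese (negPf eS) in esS.
  move=> i j; case: (ltnP i (size p).+1); last first.
    rewrite leqNgt => /ord_lastE ->; rewrite es_last.
    case: (ltnP j (size p).+1) => [/path_last h /esym//|].
    by rewrite leqNgt => /ord_lastE.
  move=> lti; case: (ltnP j (size p).+1) => [ltj|]; last first.
    by rewrite leqNgt => /ord_lastE ->; rewrite es_last => /path_last-/(_ lti).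
  move=> eij; have [_] := es_path i lti; have [_] := es_path j ltj.
  (* Equal path edges are traversed either in the same direction, so [i = j], or in opposite ones,
     which would require both [i = j + 1] and [j = i + 1]. *)
  rewrite -eij /joins => /orP[] /eqP -> /orP[] /eqP [] /vs_inj + /vs_inj.
  - by [].
  - move=> /(congr1 (@nat_of_ord _)) ei /(congr1 (@nat_of_ord _)) ej.
    by rewrite !ordSE// in ei ej; exfalso; lia.
  - move=> /(congr1 (@nat_of_ord _)) ei /(congr1 (@nat_of_ord _)) ej.
    by rewrite !ordSE// in ei ej; exfalso; lia.
  - by [].
(* The potential differences sum to zero around the circle, so they may be subtracted from the
   gains; then every term except that of [e] vanishes. *)
have sum0 : \sum_i (gain ends g (es i) (vs i) (vs (ordS i))
                     - (x (vs i) - x (vs (ordS i)))) = 0.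
  rewrite sumrB (sum_cycle_diff (x \o vs)) subr0; apply: bal => // i.
    have [/es_path[eiS _]|] := boolP (i < (size p).+1)%N.
      by rewrite inE eiS orbT.
    by move=> /ord_lastE ->; rewrite es_last inE inE eqxx.
  have [/es_path[]//|] := boolP (i < (size p).+1)%N.
  by move=> /ord_lastE ->; rewrite es_last vs_last vs_first.
move: sum0; rewrite (bigD1 ord_max)//= big1 ?addr0 => [|i im].
  by rewrite es_last vs_last vs_first => /subr0_eq.
have /es_path[eiS eij] : (i < (size p).+1)%N.
  by apply: contraR im => /ord_lastE ->.
by rewrite (gain_potential xS eiS eij) subrr.
Qed.

(** Induction on the number of edges, removing one edge [e]. If its ends stay connected, balance of
    the circle through [e] makes the old potential fit; otherwise the potential is shifted on the
    component of the tail by the constant [c] that fits [e], which no other edge notices. *)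
Lemma balanced_potential S : balanced ends g S -> exists x, potential x S.
Proof.
have [k] := ubnP #|S|; elim: k S => // k IHk S; rewrite ltnS => leS balS.
have [->|[e eS]] := set_0Vmem S.
  by exists (fun=> 0) => e; rewrite inE.
have [x xS'] : exists x, potential x (S :\ e).
  apply: IHk; last by apply: balancedS balS; exact: subD1set.
  by rewrite (leq_trans _ leS)// [X in (_ < X)%N](cardsD1 e) eS.
have e_new : e \notin S :\ e by rewrite !inE eqxx.
have [c_ht|c_ht] := boolP (connect (adj ends (S :\ e)) (hd ends e) (tl ends e)).
  exists x => e' e'S; have [->|ne] := eqVneq e' e; last first.
    by apply: xS'; rewrite !inE ne.
  have := gain_closing_edge xS' e_new _ _ _ c_ht; rewrite finset.setD1K//.
  rewrite /gain /joins /tl /hd -surjective_pairing eqxx; apply => //.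
  by rewrite eq_sym; exact: loopless.
pose in_tl w := connect (adj ends (S :\ e)) (tl ends e) w.
pose c := g e - x (tl ends e) + x (hd ends e).
exists (fun w => x w + if in_tl w then c else 0) => e' e'S.
have [->|ne] := eqVneq e' e.
  rewrite /in_tl connect0 (adj_connect_sym) (negPf c_ht) /c; ring.
have e'S' : e' \in S :\ e by rewrite !inE ne.
rewrite (xS' e' e'S') /in_tl.
rewrite (same_connect_r (adj_connect_sym ends _) (connect1 (adj_edge ends e'S'))).
case: ifP => _; ring.
Qed.

End Potential.

(** * Ranks of the lift vectors *)

Section LiftMatroid.
Variables (R : realType) (n : nat) (E : finType).
Variables (ends : E -> 'I_n * 'I_n) (g : E -> R).
Hypothesis loopless : forall e, (ends e).1 != (ends e).2.
Implicit Types (S : {set option E}) (e : E) (o : option E).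

Notation edge_vec := (edge_vec R ends).
Definition extra_vec : 'rV[R]_(n + 1) := row_mx 0 1%:M.

Definition lift_vec o : 'rV[R]_(n + 1) :=
  if o is Some e then row_mx (edge_vec e) (- g e)%:M else extra_vec.

Lemma lift_vec_decomp e :
  lift_vec (Some e) = row_mx (edge_vec e) 0 - g e *: extra_vec.
Proof.
by rewrite /lift_vec /extra_vec scale_row_mx scaler0 scalemx1 opp_row_mx oppr0 add_row_mx
  addr0 add0r raddfN.
Qed.

(** With [extra_vec] available, the gain coordinate of every edge row can be cleared, and the span
    splits into the incidence space and a line. *)
Lemma rank_lift_extra S : (extra_vec <= span_mx lift_vec S)%MS ->
  \rank (span_mx lift_vec S) = (frank ends (edges_of S)).+1.
Proof.
move=> sub_extra; pose D := span_mx edge_vec (edges_of S).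
have -> : (span_mx lift_vec S :=: block_mx D 0 (0 : 'M[R]_(1, n)) 1%:M)%MS.
  have subD e : e \in edges_of S ->
      (row_mx (edge_vec e) (0 : 'M[R]_1) <= row_mx D 0)%MS.
    move=> eS; have /submxP[X ->] := span_mx_in edge_vec eS.
    by apply/submxP; exists X; rewrite mul_mx_row mulmx0.
  apply/eqmxP/andP; split.
    have sub_x : (extra_vec <= block_mx D 0 (0 : 'M[R]_(1, n)) 1%:M)%MS.
      by rewrite /block_mx -addsmxE addsmxSr.
    apply: span_mx_sub => -[e|//] eS; rewrite lift_vec_decomp.
    rewrite addmx_sub ?eqmx_opp ?scalemx_sub//.
    rewrite /block_mx -addsmxE (submx_trans (subD _ _)) ?addsmxSl//.
    by rewrite inE.
  rewrite /block_mx -addsmxE addsmx_sub sub_extra andbT.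
  have -> : row_mx D (0 : 'M[R]_(_, 1)) =
      span_mx (fun e => row_mx (edge_vec e) 0) (edges_of S).
    apply/row_matrixP => a; rewrite row_row_mx !rowK row0.
    by case: ifP => // _; rewrite row_mx0.
  apply: span_mx_sub => e; rewrite inE => eS.
  have -> : row_mx (edge_vec e) 0 = lift_vec (Some e) + g e *: extra_vec.
    by rewrite lift_vec_decomp subrK.
  by rewrite addmx_sub ?span_mx_in ?scalemx_sub.
by rewrite rank_diag_block_mx mxrank1 rank_incidence addn1.
Qed.

(** A potential makes the gain coordinate a linear function of the vertex coordinates, so forgetting
    it loses no rank. *)
Lemma rank_lift_balanced S : None \notin S -> balanced ends g (edges_of S) ->
  \rank (span_mx lift_vec S) = frank ends (edges_of S).
Proof.
move=> NS /(balanced_potential loopless)[x xS]; rewrite -(rank_incidence R).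
pose C : 'cV[R]_n := \col_i x i.
have edgeC e : e \in edges_of S ->
    lift_vec (Some e) = edge_vec e *m row_mx 1%:M (- C).
  move=> /xS ge; rewrite mul_mx_row mulmx1 mulmxN mulmxBl -!rowE /lift_vec ge.
  congr row_mx; apply/matrixP => a b; rewrite !ord1 !mxE eqxx mulr1n; ring.
apply/eqP; rewrite eqn_leq; apply/andP; split.
  apply: leq_trans (mxrankM_maxl _ (row_mx 1%:M (- C))); apply: mxrankS.
  apply: span_mx_sub => -[e eS|NS']; last by rewrite NS' in NS.
  by rewrite edgeC ?inE// submxMr// span_mx_in// inE.
apply: leq_trans (mxrankM_maxl _ (col_mx 1%:M 0)); apply: mxrankS.
apply: span_mx_sub => e; rewrite inE => eS.
have -> : edge_vec e = lift_vec (Some e) *m col_mx 1%:M 0.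
  by rewrite mul_row_col mulmx0 addr0 mulmx1.
by rewrite submxMr// span_mx_in.
Qed.

(** Summing the edge rows, suitably signed, around a circle of nonzero gain [s] cancels all vertex
    coordinates and leaves [- s] times [extra_vec]. *)
Lemma unbalanced_extra S : ~ balanced ends g (edges_of S) ->
  (extra_vec <= span_mx lift_vec S)%MS.
Proof.
move=> unbal; have [k [vs [es [esS esj sum_neq0]]]] : exists k
    (vs : 'I_k.+2 -> 'I_n) (es : 'I_k.+2 -> E),
    [/\ forall i, es i \in edges_of S,
        forall i, joins ends (es i) (vs i) (vs (ordS i)) &
        \sum_i gain ends g (es i) (vs i) (vs (ordS i)) != 0].
  apply: contrapT => no_cycle; apply: unbal => k vs es _ _ esS esj.
  apply/eqP; apply: contrapT => /negP sum_neq0.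
  by apply: no_cycle; exists k, vs, es; split.
set s := \sum_i _ in sum_neq0.
pose step i : 'rV[R]_(n + 1) :=
  row_mx (unit_rv R (vs i) - unit_rv R (vs (ordS i)))
         (- gain ends g (es i) (vs i) (vs (ordS i)))%:M.
have sub_step i : (step i <= span_mx lift_vec S)%MS.
  have := esS i; rewrite inE => /(span_mx_in lift_vec) /=.
  rewrite /step /edge_vec /tl /hd /gain; have := esj i.
  case/orP => /eqP he; rewrite he eqxx//=.
  have /negPf -> : (vs (ordS i), vs i) != (vs i, vs (ordS i)).
    by have := loopless (es i); rewrite he; apply: contra => /eqP [-> _].
  by rewrite -eqmx_opp opp_row_mx opprB -raddfN.
have sum_step : \sum_i step i = (- s) *: extra_vec.
  rewrite -[LHS]hsubmxK !raddf_sum /=.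
  under eq_bigr do rewrite row_mxKl.
  under [X in row_mx _ X]eq_bigr do rewrite row_mxKr.
  rewrite /extra_vec scale_row_mx scaler0 scalemx1; congr row_mx.
    rewrite sumrB [X in X - _](reindex_inj (@ordS_inj _)).
    by rewrite subrr.
  by rewrite -raddf_sum sumrN.
rewrite -(eqmx_scale _ (_ : - s != 0)) ?oppr_eq0// -sum_step.
by apply: summx_sub.
Qed.

Lemma rank_lift S : \rank (span_mx lift_vec S) = lrank ends g S.
Proof.
rewrite /lrank; case: ifP => [/andP[NS /asboolP bS]|/negbT].
  by rewrite rank_lift_balanced// addn0.
move=> h; rewrite rank_lift_extra ?addn1//; move: h.
rewrite negb_and negbK => /orP[NS|/asboolPn].
  exact: (span_mx_in lift_vec NS).
exact: unbalanced_extra.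
Qed.

End LiftMatroid.

(** * The affine and projective arrangements *)

Section DotProduct.
Variables (R : realType) (d : nat).

Lemma dotrE (u v : 'rV[R]_d) : u *m v^T = (dotr u v)%:M.
Proof. exact: mx11_scalar. Qed.

Lemma dotrC (u v : 'rV[R]_d) : dotr u v = dotr v u.
Proof. by rewrite /dotr -[in LHS](trmxK u) -trmx_mul mxE. Qed.

Lemma dotrDl (u v w : 'rV[R]_d) : dotr (u + v) w = dotr u w + dotr v w.
Proof. by rewrite /dotr mulmxDl mxE. Qed.

Lemma dotrNl (u w : 'rV[R]_d) : dotr (- u) w = - dotr u w.
Proof. by rewrite /dotr mulNmx mxE. Qed.

Lemma dotrBl (u v w : 'rV[R]_d) : dotr (u - v) w = dotr u w - dotr v w.
Proof. by rewrite dotrDl dotrNl. Qed.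

Lemma dotrZl c (u w : 'rV[R]_d) : dotr (c *: u) w = c * dotr u w.
Proof. by rewrite /dotr -scalemxAl mxE. Qed.

End DotProduct.

(** * The projective arrangement as a family of linear forms *)

Section Functionals.
Variables (R : realType) (n d : nat) (E : finType).
Variables (ends : E -> 'I_n * 'I_n) (g : E -> R).
Hypothesis loopless : forall e, (ends e).1 != (ends e).2.
Variable Q : 'M[R]_(n, d).
Implicit Types (S T : {set option E}) (o : option E).

(** The coefficients of the affine function sending [P] to the squared distance from [P] to [q]
    minus the squared norm of [P]; the subtracted term cancels in [psi]. *)
Definition paraboloid (q : 'rV[R]_d) : 'rV[R]_(d + 1) :=
  row_mx (- 2%:R *: q) (dotr q q)%:M.

Definition at_infinity : 'rV[R]_(d + 1) := row_mx 0 1%:M.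

Definition functional o : 'rV[R]_(d + 1) :=
  lift_vec ends g o *m image_mx paraboloid at_infinity Q.

Definition homog (x : 'rV[R]_d * R) : 'cV[R]_(d + 1) := col_mx x.1^T x.2%:M.

Lemma functional_None : functional None = at_infinity.
Proof. by rewrite /functional /= mul_row_col mul0mx add0r mul1mx. Qed.

Lemma functional_Some e : functional (Some e) =
  paraboloid (row (tl ends e) Q) - paraboloid (row (hd ends e) Q)
  - g e *: at_infinity.
Proof.
by rewrite /functional /= mul_row_col mulmxBl -!rowE !rowK mul_scalar_mx scaleNr.
Qed.

Lemma functional_homog o x : functional o *m homog x = 0 <-> hP ends g Q o x.
Proof.
case: o => [e|]; last first.
  rewrite functional_None mul_row_col mul0mx add0r mul1mx /= /hinf /=.
  split=> [/matrixP/(_ 0 0)|->]; last by rewrite raddf0.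
  by rewrite !mxE.
rewrite functional_Some !mulmxBl -scalemxAl !mul_row_col mul0mx add0r mul1mx.
rewrite -!scalar_mxM -!scalemxAl !dotrE !scale_scalar_mx.
rewrite /= /hypP /= [dotr x.1 _]dotrC.
rewrite dotrZl dotrBl.
rewrite -!raddfD -!raddfN -!raddfD /=.
split=> [/matrixP/(_ 0 0)|h]; last first.
  rewrite -[RHS](raddf0 (@scalar_mx _ _)); congr _%:M; lra.
rewrite !mxE mulr1n => h; lra.
Qed.

Lemma homog_surj (y : 'cV[R]_(d + 1)) : exists x, y = homog x.
Proof.
exists ((usubmx y)^T, dsubmx y 0 0).
by rewrite /homog /= trmxK -mx11_scalar vsubmxK.
Qed.

Lemma interPE S x :
  interP ends g Q S x <-> span_mx functional S *m homog x = 0.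
Proof.
split=> [hx|kx o oS].
  by apply: span_mx_eq0 => o /hx /functional_homog.
apply/functional_homog; have /submxP[D ->] := span_mx_in functional oS.
by rewrite -mulmxA kx mulmx0.
Qed.

(** Duality: a form vanishing on the common kernel of a family lies in its span. The columns of the
    cokernel matrix, read as homogeneous points, serve as test vectors. *)
Lemma EofP_interP S o :
  (o \in EofP ends g Q (interP ends g Q S)) =
  (functional o <= span_mx functional S)%MS.
Proof.
rewrite inE; apply/asboolP/idP => [sub_o|/submxP[D hD] x /interPE kx]; last first.
  by apply/functional_homog; rewrite hD -mulmxA kx mulmx0.
rewrite submxE; apply/eqP/matrixP => i j.
set C := cokermx _; have [x Cx] := homog_surj (col j C).
have : functional o *m col j C = 0.
  rewrite Cx; apply/functional_homog/sub_o/interPE.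
  by rewrite -Cx colE mulmxA mulmx_coker mul0mx.
by move/matrixP/(_ i 0); rewrite colE mulmxA -colE !mxE.
Qed.

Lemma sub_EofP_interP S : S \subset EofP ends g Q (interP ends g Q S).
Proof.
by apply/fintype.subsetP => o oS; rewrite EofP_interP span_mx_in.
Qed.

Lemma interP_EofP x : inLP ends g Q x -> interP ends g Q (EofP ends g Q x) = x.
Proof.
case=> T ->; apply/seteqP; split=> y hy o oT.
  by apply: hy; exact: (fintype.subsetP (sub_EofP_interP T)).
by move: oT; rewrite inE => /asboolP; exact.
Qed.

Definition generic_ranks :=
  forall S, \rank (span_mx functional S) = minn (lrank ends g S) (d + 1).

Hypothesis Q_generic : generic_ranks.

Lemma lrankS S T : S \subset T -> (lrank ends g S <= lrank ends g T)%N.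
Proof.
by move=> sST; rewrite -!(rank_lift g loopless) mxrankS// span_mxS.
Qed.

(** Below rank [d + 1] the truncation still shows whether adding [o] raises the lift rank. *)
Lemma EofP_rank S o : (lrank ends g S <= d)%N ->
  (o \in EofP ends g Q (interP ends g Q S)) =
  (lrank ends g (o |: S) == lrank ends g S).
Proof.
move=> leS; rewrite EofP_interP -rank_span_mxU1 !Q_generic.
have := lrankS (finset.subsetUr [set o] S); rewrite addn1; lia.
Qed.

Lemma flat_EofP S : lflat ends g S -> (lrank ends g S <= d)%N ->
  EofP ends g Q (interP ends g Q S) = S.
Proof.
move=> flatS leS; apply/eqP; rewrite finset.eqEsubset sub_EofP_interP andbT.
apply/fintype.subsetP => o; rewrite EofP_rank//; apply: contraTT => /flatS.
by rewrite neq_ltn orbC => ->.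
Qed.

Lemma generic_PGP : arr_defined ends Q -> PGP ends g Q.
Proof.
move=> defd; split=> // [x xL|S trS|x y xL yL].
- set F := EofP ends g Q x; have closF : EofP ends g Q (interP ends g Q F) = F.
    by rewrite interP_EofP.
  (* Up to rank [d] the closed set [F] is a flat of the lift matroid. Beyond, its forms span all of
     the dual space, so every form belongs to [F], the top of the truncation. *)
  have [leF|ltF] := leqP (lrank ends g F) d; [left|right].
    split=> // o oF; rewrite ltn_neqAle lrankS ?finset.subsetUr// andbT eq_sym.
    by rewrite -EofP_rank// closF.
  apply/eqP; rewrite -finset.subTset -closF; apply/fintype.subsetP => o _.
  rewrite EofP_interP; apply: submx_full; rewrite /row_full Q_generic.
  by rewrite (minn_idPr _)// addn1.
- exists (interP ends g Q S); split; first by exists S.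
  case: trS => [[flatS leS]|->]; first exact: flat_EofP.
  by apply/eqP; rewrite -finset.subTset sub_EofP_interP.
- split=> [syx|/fintype.subsetP sE].
    apply/fintype.subsetP => o; rewrite [in X in X -> _]inE => /asboolP sxo.
    by rewrite inE; apply/asboolP; exact: classical_sets.subset_trans sxo.
  rewrite -(interP_EofP xL) -(interP_EofP yL) => z hz o ox.
  exact/hz/sE.
Qed.

End Functionals.

(** * Balanced flats as lift flats avoiding the extra point *)

Section BalancedFlats.
Variables (R : realType) (n : nat) (E : finType).
Variables (ends : E -> 'I_n * 'I_n) (g : E -> R).
Implicit Types (S : {set option E}) (T : {set E}) (e : E).

Lemma edges_of_Some T : edges_of (Some @: T) = T.
Proof. by apply/setP => e; rewrite inE mem_imset. Qed.

Lemma None_notin_Some T : None \notin (Some @: T)%SET.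
Proof. by apply/imsetP => -[]. Qed.

Lemma edges_of_None S : edges_of (None |: S) = edges_of S.
Proof. by apply/setP => e; rewrite !inE. Qed.

Lemma edges_of_U1 S e : edges_of (Some e |: S) = (edges_of S :|: [set e])%SET.
Proof. by apply/setP => e'; rewrite !inE orbC. Qed.

Lemma frankU1 T e : connect (adj ends T) (tl ends e) (hd ends e) ->
  frank ends (T :|: [set e])%SET = frank ends T.
Proof.
by rewrite finset.setUC -!(rank_incidence R) -(sub_incidence R) -rank_span_mxU1 => /eqP.
Qed.

Lemma ltn_frankU1 T e : ~~ connect (adj ends T) (tl ends e) (hd ends e) ->
  (frank ends T < frank ends (T :|: [set e])%SET)%N.
Proof.
rewrite finset.setUC -!(rank_incidence R) -(sub_incidence R) -rank_span_mxU1.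
by move=> ne; rewrite ltn_neqAle eq_sym ne mxrankS// span_mxS// finset.subsetUr.
Qed.

Lemma lrank_balanced S : None \notin S -> balanced ends g (edges_of S) ->
  lrank ends g S = frank ends (edges_of S).
Proof. by move=> NS /asboolP bS; rewrite /lrank NS bS addn0. Qed.

Lemma lrank_extra S : None \in S \/ ~ balanced ends g (edges_of S) ->
  lrank ends g S = (frank ends (edges_of S)).+1.
Proof.
rewrite /lrank => -[->|/asboolPn/negPf->]; first by rewrite addn1.
by rewrite andbF addn1.
Qed.

(** Adding [None] to an unbalanced set, or an edge inside a component without losing balance, would
    keep the rank, against flatness. *)
Lemma lflat_bal_flat S : None \notin S -> lflat ends g S ->
  bal_flat ends g (edges_of S) /\ frank ends (edges_of S) = lrank ends g S.
Proof.
move=> NS flatS; have balS : balanced ends g (edges_of S).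
  apply: contrapT => unbal; have := flatS None NS.
  rewrite (lrank_extra (or_intror unbal)) lrank_extra; last by left; rewrite finset.setU11.
  by rewrite edges_of_None ltnn.
rewrite lrank_balanced//; do !split=> //.
move=> e eS conn balSe; rewrite inE in eS; have := flatS (Some e) eS.
rewrite lrank_balanced// lrank_balanced ?edges_of_U1//.
  by rewrite frankU1// ltnn.
by rewrite !inE.
Qed.

(** Each new element raises the rank: [None] by definition, an edge inside a component by destroying
    balance, and an edge between components by merging them. *)
Lemma bal_flat_lflat T : bal_flat ends g T ->
  lflat ends g (Some @: T) /\ lrank ends g (Some @: T) = frank ends T.
Proof.
case=> balT maxT; have rankT : lrank ends g (Some @: T)%SET = frank ends T.
  by rewrite lrank_balanced ?edges_of_Some// None_notin_Some.
split=> // -[e|] notin; rewrite rankT; last first.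
  rewrite lrank_extra; last by left; rewrite finset.setU11.
  by rewrite edges_of_None edges_of_Some.
have eT : e \notin T by rewrite mem_imset in notin.
have [conn|disconn] := boolP (connect (adj ends T) (tl ends e) (hd ends e)).
  rewrite lrank_extra ?edges_of_U1 ?edges_of_Some; last by right; exact: maxT.
  by rewrite frankU1.
have := ltn_frankU1 disconn.
move=> /leq_trans; apply.
by rewrite -{1}(edges_of_Some T) -edges_of_U1 leq_addr.
Qed.

End BalancedFlats.

(** * From the projective to the affine arrangement *)

Section AffineProjective.
Variables (R : realType) (n d : nat) (E : finType).
Variables (ends : E -> 'I_n * 'I_n) (g : E -> R).
Variable Q : 'M[R]_(n, d).
Implicit Types (S : {set option E}) (T : {set E}) (e : E) (o : option E).
Implicit Types (P v : 'rV[R]_d) (c : R).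

Lemma sqdistE P v : sqdist P v = dotr P P - 2%:R * dotr P v + dotr v v.
Proof.
rewrite /sqdist dotrBl [dotr P _]dotrC [dotr v (P - v)]dotrC !dotrBl (dotrC v P).
ring.
Qed.

Lemma hyp_hP e P : hyp ends g Q e P <-> hP ends g Q (Some e) (P, 1).
Proof.
rewrite /= /hyp /hypP /psi /= !sqdistE mulr1.
rewrite [dotr P (_ *: _)]dotrC dotrZl dotrBl !(dotrC _ P).
by split=> h; lra.
Qed.

Lemma interA_interP T P :
  interA ends g Q T P <-> interP ends g Q (Some @: T)%SET (P, 1).
Proof.
split=> [hP _ /imsetP[e eT ->]|hP e eT]; first exact/hyp_hP/hP.
by apply/hyp_hP/hP; rewrite mem_imset.
Qed.

Lemma hP_scale o c v : c != 0 -> hP ends g Q o (c^-1 *: v, 1) <-> hP ends g Q o (v, c).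
Proof.
move=> c0; have homogZ : homog (v, c) = c *: homog (c^-1 *: v, 1).
  by rewrite /homog scale_col_mx linearZ /= scalerA divff// scale1r scalemx1.
rewrite -!functional_homog homogZ -scalemxAr.
split=> [->|/eqP]; first exact: scaler0.
by rewrite scaler_eq0 (negPf c0) => /eqP.
Qed.

Lemma hP_direction o P v : hP ends g Q o (P, 1) ->
  hP ends g Q o (P + v, 1) <-> hP ends g Q o (v, 0).
Proof.
move=> hoP; have homogD : homog (P + v, 1) = homog (P, 1) + homog (v, 0).
  by rewrite /homog add_col_mx linearD /= raddf0 addr0.
rewrite -!functional_homog homogD mulmxDr.
by move/functional_homog : hoP => ->; rewrite add0r.
Qed.

(** A projective intersection not contained in the ideal hyperplane has a point with nonzero last
    coordinate, which rescales to an affine point. *)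
Lemma interA_nonempty T :
  interA ends g Q T !=set0 <->
  None \notin EofP ends g Q (interP ends g Q (Some @: T)%SET).
Proof.
split=> [[P /interA_interP hP]|].
  rewrite inE; apply/asboolPn => /(_ _ hP) /eqP; rewrite /= oner_eq0//.
rewrite inE => /asboolPn/existsNP[[v c] /not_implyP[hv /eqP c0]].
exists (c^-1 *: v); apply/interA_interP => o oT.
by apply/hP_scale => //; exact: hv.
Qed.

Lemma EofA_EofP T : interA ends g Q T !=set0 ->
  EofA ends g Q (interA ends g Q T) =
  edges_of (EofP ends g Q (interP ends g Q (Some @: T)%SET)).
Proof.
case=> P0 P0T; apply/setP => e; rewrite !inE.
apply/asboolP/asboolP => [sub [v c] hv|sub P /interA_interP hP]; last first.
  by apply/hyp_hP/sub.
have [c0|c0] := eqVneq c 0; last first.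
  apply/hP_scale => //; apply/hyp_hP/sub/interA_interP => o oT.
  by apply/hP_scale => //; exact: hv.
(* An ideal point is a direction [v]: translating [P0] by [v] stays in the intersection, hence in
   the hyperplane of [e], which therefore contains this direction. *)
rewrite c0 in hv *; have hP0 := (hyp_hP e P0).1 (sub _ P0T).
apply/(hP_direction _ hP0)/hyp_hP/sub/interA_interP => o oT.
by apply/hP_direction; [exact: (interA_interP T P0).1 | exact: hv].
Qed.

Lemma interA_EofA s : inLA ends g Q s -> interA ends g Q (EofA ends g Q s) = s.
Proof.
case=> -[T ->] _; apply/seteqP; split=> P hP e eT.
  by apply: hP; rewrite inE; apply/asboolP => P'; exact.
by move: eT; rewrite inE => /asboolP; exact.
Qed.

Lemma PGP_GP : PGP ends g Q -> GP ends g Q.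
Proof.
case=> defd P_flat flat_P _; split=> //.
- move=> _ [[T ->] ne]; rewrite EofA_EofP//.
  set F := EofP _ _ _ _; have NF : None \notin F by exact/interA_nonempty.
  have : trunc_elt ends g d F by apply: P_flat; exists (Some @: T)%SET.
  case=> [[flatF leF]|FT]; last by rewrite FT inE in NF.
  by have [? ->] := lflat_bal_flat NF flatF.
- move=> T flatT leT; have [flatS rankS] := bal_flat_lflat flatT.
  have [|x [xL Ex]] := flat_P (Some @: T)%SET; first by left; rewrite rankS.
  have eqx : interP ends g Q (Some @: T)%SET = x by rewrite -Ex interP_EofP.
  have ne : interA ends g Q T !=set0.
    by apply/interA_nonempty; rewrite eqx Ex None_notin_Some.
  exists (interA ends g Q T); split; first by split=> //; exists T.
  by rewrite EofA_EofP// eqx Ex edges_of_Some.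
- move=> s t sL tL; split=> [sts|/fintype.subsetP sE].
    apply/fintype.subsetP => e; rewrite [in X in X -> _]inE => /asboolP sse.
    by rewrite inE; apply/asboolP; exact: classical_sets.subset_trans sse.
  rewrite -(interA_EofA sL) -(interA_EofA tL) => P hP e es.
  exact/hP/sE.
Qed.

End AffineProjective.

(** * Ideal points and genericity *)

Section Directions.
Variables (R : realType) (n d : nat).
Implicit Types (T : {set 'I_n * 'I_n}).

Notation pair_vec := (edge_vec R (@id ('I_n * 'I_n))).

(** A set of pairs is viewed as a graph whose edges are the pairs themselves, so that
    [rank_incidence] applies to ideal points. *)
Lemma frank_pair T : frank (@id ('I_n * 'I_n)) T = (n - pair_ncomp T)%N.
Proof.
rewrite /frank /ncomp /pair_ncomp; congr (_ - _)%N; apply: eq_n_comp => u w.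
apply: eq_connect => {}u {}w /=; rewrite /adj /joins.
apply/existsP/orP => [[e /andP[eT /orP[]/eqP he]]|[uwT|wuT]].
- by left; rewrite -he.
- by right; rewrite -he.
- by exists (u, w); rewrite uwT eqxx.
- by exists (w, u); rewrite wuT eqxx orbT.
Qed.

Definition generic_directions (Q : 'M[R]_(n, d)) := forall T,
  \rank (span_mx pair_vec T *m Q) = minn (\rank (span_mx pair_vec T)) d.

Lemma generic_IGP Q : (0 < d)%N -> generic_directions Q -> IGP Q.
Proof.
move=> d0 Qgen; split=> [i j eq_ij|T _].
  (* Distinctness is the case of a single pair: its direction has rank [minn 1 d], which is
     positive. *)
  apply: contrapT => /eqP ij; have := Qgen [set (i, j)]%SET.
  rewrite span_mx_eq0 => [|p /finset.set1P ->]; last first.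
    by rewrite mulmxBl -!rowE /= eq_ij subrr.
  have : (0 < \rank (span_mx pair_vec [set (i, j)]%SET))%N.
    rewrite lt0n mxrank_eq0; apply: contra ij => /eqP span0.
    have := span_mx_in pair_vec (finset.set11 (i, j)).
    rewrite span0 => /submx0null/rowP/(_ i); rewrite !mxE !eqxx /=.
    by case: eqP => //= _ /eqP; rewrite subr0 oner_eq0.
  rewrite mxrank0; lia.
have -> : (\sum_(p in T) <<row p.1 Q - row p.2 Q>> :=: span_mx pair_vec T *m Q)%MS.
  rewrite span_mxM; apply/eqmxP/andP; split.
    apply/sumsmx_subP => p pT; rewrite genmxE.
    by have := span_mx_in (fun p => pair_vec p *m Q) pT; rewrite mulmxBl -!rowE.
  apply: span_mx_sub => p pT; rewrite mulmxBl -!rowE (sumsmx_sup p)// genmxE//.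
by rewrite Qgen rank_incidence frank_pair.
Qed.

End Directions.

(** * Spanning by small moves, and finite intersections of open dense sets *)

Section Genericity.
Variables (R : realType) (n d : nat).
Hypothesis d_gt0 : (0 < d)%N.

Lemma dotr_gt0 (v : 'rV[R]_d) : v != 0 -> 0 < dotr v v.
Proof.
move=> /matrix0Pn[i [j vj]]; rewrite /dotr mxE (bigD1 j)//= mxE ltr_pwDl//.
  by rewrite -expr2 exprn_even_gt0//= -(ord1 i).
by apply: sumr_ge0 => k _; rewrite mxE -expr2 sqr_ge0.
Qed.

(** The expression vanishes for at most one [t], so one of the two candidates [e / 2] and [e / 4]
    works. *)
Lemma small_scale (b e : R) : 0 < e ->
  exists t : R, [/\ 0 < t, t < e & 2%:R + b * t != 0].
Proof.
move=> e0; have [h|h] := eqVneq (2%:R + b * (e / 2%:R)) 0; last first.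
  by exists (e / 2%:R); split=> //; lra.
exists (e / 4%:R); split; [lra | lra |].
by apply/eqP => h'; lra.
Qed.

(** With [l = (a, b)] and [y = b *: q - a], a move by [t *: c] pairs with [l] to
    [2 t (c.y) + b t^2 |c|^2]. If [y] is nonzero, [c = y] gives [t |y|^2 (2 + b t)]; if [y = 0],
    then [b] is nonzero and any nonzero [c] works. *)
Lemma paraboloid_spanning : locally_spanning (@paraboloid R d).
Proof.
move=> q l l0; pose a := (usubmx l)^T; pose b := dsubmx l 0 0.
have lE : l = col_mx a^T b%:M by rewrite trmxK -mx11_scalar vsubmxK.
have incr c t : (paraboloid (q + t *: c) - paraboloid q) *m l =
    (2%:R * t * dotr c (b *: q - a) + b * t ^+ 2 * dotr c c)%:M.
  rewrite [X in _ *m X]lE /paraboloid opp_row_mx add_row_mx mul_row_col.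
  rewrite scalerDr [- 2%:R *: q + _]addrC addrK scalerA -scalemxAl dotrE.
  rewrite scale_scalar_mx -raddfN -raddfD -scalar_mxM -raddfD; congr _%:M.
  rewrite [dotr c (b *: q - a)]dotrC !dotrDl dotrNl !dotrZl.
  rewrite ![dotr _ (q + t *: c)]dotrC !dotrDl !dotrZl (dotrC q c) (dotrC a c).
  ring.
have incr_neq0 c t : 2%:R * t * dotr c (b *: q - a) + b * t ^+ 2 * dotr c c != 0 ->
    (paraboloid (q + t *: c) - paraboloid q) *m l != 0.
  by rewrite incr; apply: contra => /eqP/matrixP/(_ 0 0); rewrite !mxE mulr1n => ->.
have [y0|y0] := eqVneq (b *: q - a) 0.
  have b0 : b != 0.
    apply: contra l0 => /eqP b0; move: y0; rewrite lE b0 scale0r sub0r => /eqP.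
    by rewrite oppr_eq0 => /eqP ->; rewrite trmx0 raddf0 col_mx0.
  exists (const_mx 1) => e e0; exists (e / 2%:R).
    by rewrite gtr0_norm ?divr_gt0//; lra.
  apply: incr_neq0; rewrite y0 {1}/dotr trmx0 mulmx0 mxE mulr0 add0r.
  have c0 : const_mx 1 != 0 :> 'rV[R]_d.
    by apply/matrix0Pn; exists 0, (Ordinal d_gt0); rewrite mxE oner_neq0.
  have e2 : e / 2%:R != 0 by apply: lt0r_neq0; rewrite divr_gt0.
  by rewrite !mulf_neq0 ?expf_neq0// lt0r_neq0// dotr_gt0.
exists (b *: q - a) => e e0.
have [t [t0 te tb]] := small_scale b e0.
exists t; first by rewrite gtr0_norm.
apply: incr_neq0; set D := dotr _ _.
have -> : 2%:R * t * D + b * t ^+ 2 * D = t * D * (2%:R + b * t) by ring.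
by rewrite !mulf_neq0// ?lt0r_neq0// dotr_gt0.
Qed.

Lemma id_spanning : locally_spanning (@id 'rV[R]_d).
Proof.
move=> q l l0; exists l^T => e e0; exists (e / 2%:R).
  by rewrite gtr0_norm ?divr_gt0//; lra.
rewrite addrC addKr -scalemxAl scaler_eq0 negb_or lt0r_neq0 ?divr_gt0//=.
have lT0 : l^T != 0 by rewrite trmx_eq0.
have := dotr_gt0 lT0; rewrite /dotr trmxK => /lt0r_neq0.
by apply: contra => /eqP ->; rewrite mxE.
Qed.

Lemma paraboloid_continuous j : continuous (fun q : 'rV[R]_d => paraboloid q 0 j).
Proof.
rewrite /paraboloid; case: (split_ordP j) => j' ->.
  under eq_fun do rewrite row_mxEl mxE.
  move=> q; apply: (@cvgM _ _ (nbhs q) _ (fun=> - 2%:R)); first exact: cvg_cst.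
  exact: coord_continuous.
have -> : (fun q : 'rV[R]_d => row_mx (- 2%:R *: q) (dotr q q)%:M 0 (rshift d j')) =
    (fun q : 'rV[R]_d => \sum_k q 0 k * q 0 k).
  apply/funext => q; rewrite row_mxEr (ord1 j') mxE eqxx mulr1n /dotr mxE.
  by apply: eq_bigr => k _; rewrite mxE.
apply: continuous_big; first exact: add_continuous.
move=> k _.
move=> q; apply: (@cvgM _ _ (nbhs q) _ (fun q => q 0 k) (fun q => q 0 k));
  exact: coord_continuous.
Qed.

(** Openness and density go through the induction together, because two dense sets are sure to meet
    densely only when one of them is open. *)
Lemma open_dense_forall (T : topologicalType) (I : finType) (A : I -> set T) :
  (forall i, open (A i) /\ dense (A i)) ->
  open [set x | forall i, A i x] /\ dense [set x | forall i, A i x].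
Proof.
move=> hA.
suff [oA dA] : open [set x | forall i, i \in enum I -> A i x] /\
             dense [set x | forall i, i \in enum I -> A i x].
  have -> // : [set x | forall i, A i x] = [set x | forall i, i \in enum I -> A i x].
  by apply/seteqP; split=> x hx i => [_|]; apply: hx; rewrite ?mem_enum.
elim: (enum I) => [|i s [oA dA]].
  have -> : [set x | forall i, i \in [::] -> A i x] = [set: T].
    by apply/seteqP; split.
  by split; [exact: openT | move=> O [x Ox] _; exists x].
have -> : [set x | forall j, j \in i :: s -> A j x] =
    A i `&` [set x | forall j, j \in s -> A j x].
  apply/seteqP; split=> [x hx|x [hi hs] j]; last by rewrite inE => /orP[/eqP->|/hs].
  by split=> [|j js]; apply: hx; rewrite inE ?eqxx ?js ?orbT.
by have [oi di] := hA i; split; [exact: openI | exact: denseI].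
Qed.

End Genericity.

Unset Implicit Arguments.
Set Strict Implicit.

Theorem theorem6p1 (R : realType) (n d : nat) (E : finType)
    (ends : E -> 'I_n * 'I_n) (g : E -> R)
    (Hloopless : forall e, (ends e).1 != (ends e).2)
    (Hdn : (d < n)%N) (Hd : (1 <= d)%N) :
  exists U : set 'M[R]_(n, d),
    [/\ open U, dense U &
        U `<=` [set Q | [/\ IGP Q, GP ends g Q & PGP ends g Q]]].
Proof.
pose K0 : 'M[R]_(0, d) := 0.
have K0_free : row_free K0 by rewrite /row_free -leqn0 rank_leq_row.
have K1_free : row_free (@at_infinity R d).
  by rewrite /row_free rank_row_0mx mxrank1.
pose N S := span_mx (lift_vec ends g) S.
(* The empty column block matches the empty [K0], so that [D T *m image_mx id K0 Q] is the matrix of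
   the directions of [T]. *)
pose D (T : {set 'I_n * 'I_n}) :=
  row_mx (span_mx (edge_vec R id) T) (0 : 'M[R]_(_, 0)).
pose UP S : set 'M[R]_(n, d) := [set Q |
  (minn (\rank (N S)) (d + 1) <=
     \rank (N S *m image_mx (@paraboloid R d) (@at_infinity R d) Q))%N].
pose UI T : set 'M[R]_(n, d) := [set Q |
  (minn (\rank (D T)) d <= \rank (D T *m image_mx id K0 Q))%N].
have [oP dP] : open [set Q | forall S, UP S Q] /\ dense [set Q | forall S, UP S Q].
  apply: open_dense_forall => S; split.
    by apply: generic_rank_open; exact: paraboloid_continuous.
  by apply: generic_rank_dense => //; exact: paraboloid_spanning.
have [oI dI] : open [set Q | forall T, UI T Q] /\ dense [set Q | forall T, UI T Q].
  apply: open_dense_forall => T; split.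
    by apply: generic_rank_open => j; exact: coord_continuous.
  by apply: generic_rank_dense => //; exact: id_spanning.
exists ([set Q | forall S, UP S Q] `&` [set Q | forall T, UI T Q]).
split; [exact: openI | exact: denseI | move=> Q [QP QI]].
(* Only the lower bounds on the ranks need genericity; the upper bounds hold for every product of
   matrices. *)
have Q_ranks : generic_ranks ends g Q.
  move=> S; rewrite -rank_lift// -span_mxM; apply/eqP.
  by rewrite eqn_leq QP leq_min mxrankM_maxl rank_leq_col.
have Q_dirs : generic_directions Q.
  move=> T; apply/eqP; rewrite eqn_leq leq_min mxrankM_maxl rank_leq_col /=.
  have := QI T; rewrite /UI /= rank_row_mx0 /image_mx mul_row_col mul0mx addr0.
  by have -> : \matrix_i row i Q = Q by apply/row_matrixP => i; rewrite rowK.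
have Q_IGP : IGP Q by exact: generic_IGP.
have defd : arr_defined ends Q.
  move=> e; apply: contra (Hloopless e) => /eqP eq_rows.
  by apply/eqP/Q_IGP.1.
have Q_PGP : PGP ends g Q by exact: generic_PGP.
by split=> //; exact: PGP_GP.
Qed.
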